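(* Let $1<p<\infty$ and $\frac1p+\frac1q=1$. Let $(\Omega,\mathcal{A})$ be a measurable space, $X,Y$ Banach spaces and $\nu:\mathcal{A}\to Y$ a $\sigma$-additive vector measure. If $f\in L^p_w(\nu,X,Y)$ and $g\in L^q_w(\nu,X,Y)$, then $$\sup_{\|y'\|\le1}\left\{\int_\Omega\|f(w)\|_X\|g(w)\|_X\,d|y'\circ\nu|(w)\right\}\le\|f\|_{L^p_w(\nu,X,Y)}\,\|g\|_{L^q_w(\nu,X,Y)},$$ where the supremum is over $y'\in Y'$ with $\|y'\|\le 1$.
   Context: $Y'$ denotes the dual of $Y$. For $y'\in Y'$, $y'\circ\nu$ is the scalar measure $E\mapsto y'(\nu(E))$ and $|y'\circ\nu|$ is its total variation measure. The semivariation of $\nu$ is $\|\nu\|(E)=\sup_{\|y'\|\le 1}|y'\circ\nu|(E)$; ''almost everywhere'' and equivalence classes refer to sets $E\in\mathcal{A}$ with $\|\nu\|(E)=0$ being null. A simple function is a finite sum $\sum_i x_i\chi_{A_i}$ with $x_i\in X$, $A_i\in\mathcal{A}$. A function $f:\Omega\to X$ is $\nu$-measurable (strongly measurable) if there is a sequence of simple functions converging to $f$ in the norm of $X$, $\|\nu\|$-almost everywhere. For $1\le r<\infty$, $L^r_w(\nu,X,Y)$ is the space of ($\|\nu\|$-equivalence classes of) $\nu$-measurable functions $f:\Omega\to X$ such that $\int_\Omega\|f\|^r\,d|y'\circ\nu|<\infty$ for every $y'\in Y'$, with norm $$\|f\|_{L^r_w(\nu,X,Y)}=\sup_{\|y'\|\le1}\left(\int_\Omega\|f\|^r\,d|y'\circ\nu|\right)^{1/r}.$$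 *)

(* Defs.v *)
From HB Require Import structures.
From mathcomp Require Import all_boot all_order all_algebra.
From mathcomp Require Import complex.
From mathcomp Require Import all_classical all_reals all_analysis.

Set Implicit Arguments.
Unset Strict Implicit.
Unset Printing Implicit Defensive.

Import Order.TTheory GRing.Theory Num.Theory.
Import numFieldNormedType.Exports.

Local Open Scope classical_set_scope.
Local Open Scope ring_scope.

(* "Banach space" covers both real and complex scalars: all notions below are
   indexed by the kind of scalars. *)
Variant scalar_kind := RealScalars | ComplexScalars.

Definition scalar_field (R : realType) (k : scalar_kind) : numFieldType :=
  match k with
  | RealScalars => R
  | ComplexScalars => R[i]
  end.

(* The library norm of a complex number (or of a vector of a complex normed
   space) is an element of R[i] with zero imaginary part, hence the Re. *)
Definition modulus (R : realType) (k : scalar_kind) : scalar_field R k -> R :=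
  match k with
  | RealScalars => fun x : R => `|x|
  | ComplexScalars => fun z : R[i] => complex.Re `|z|
  end.

Definition vnorm (R : realType) (k : scalar_kind)
  (V : normedModType (scalar_field R k)) (v : V) : R := modulus `|v|.

Section vector_measures.
Context {d : measure_display} {T : measurableType d} {R : realType}
        {k : scalar_kind}.
Local Notation K := (scalar_field R k).

(* The case where all the sets are empty forces nu set0 = 0. *)
Definition vector_measure (Y : normedModType K) (nu : set T -> Y) : Prop :=
  forall A : (set T)^nat, (forall n, measurable (A n)) -> trivIset setT A ->
    (fun n => \sum_(0 <= i < n) nu (A i)) @ \oo --> nu (\bigcup_n A n).

Definition total_variation (mu : set T -> K) (E : set T) : \bar R :=
  ereal_sup [set s | exists n (F : 'I_n -> set T),
    [/\ forall i, measurable (F i), trivIset setT F,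
        \bigcup_i F i = E &
        s = (\sum_(i < n) modulus (mu (F i)))%:E]].

Definition scalar_variation (Y : normedModType K) (nu : set T -> Y)
    (y' : {linear Y -> K^o}) : set T -> \bar R :=
  total_variation (y' \o nu).

Definition topological_dual (Y : normedModType K) : set {linear Y -> K^o} :=
  [set y' | continuous (y' : Y -> K^o)].

Definition dual_norm (Y : normedModType K) (y' : {linear Y -> K^o}) : \bar R :=
  ereal_sup [set (modulus (y' y))%:E | y in [set y : Y | vnorm y <= 1]].

Definition dual_unit_ball (Y : normedModType K) : set {linear Y -> K^o} :=
  [set y' | topological_dual y' /\ (dual_norm y' <= 1)%E].

Definition semivariation (Y : normedModType K) (nu : set T -> Y)
    (E : set T) : \bar R :=
  ereal_sup [set scalar_variation nu y' E | y' in @dual_unit_ball Y].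

Definition simple_function (X : normedModType K) (s : T -> X) : Prop :=
  exists n (x : 'I_n -> X) (A : 'I_n -> set T),
    (forall i, measurable (A i)) /\
    s = (fun w => \sum_(i < n) (\1_(A i) w : K) *: x i).

Definition nu_measurable (X Y : normedModType K) (nu : set T -> Y)
    (f : T -> X) : Prop :=
  exists s : nat -> T -> X, (forall n, simple_function (s n)) /\
    {ae semivariation nu, forall w, s n w @[n --> \oo] --> f w}.

(* The integrands below need only be measurable up to a null set. For such
   nonnegative functions the library integral (a supremum over measurable
   simple minorants) is the integral for the completed measure. *)
Definition in_Lw (X Y : normedModType K) (nu : set T -> Y) (r : R)
    (f : T -> X) : Prop :=
  nu_measurable nu f /\
  forall y', @topological_dual Y y' ->
    (\int[scalar_variation nu y']_w (vnorm (f w) `^ r)%:E < +oo)%E.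

Definition Lw_norm (X Y : normedModType K) (nu : set T -> Y) (r : R)
    (f : T -> X) : \bar R :=
  ereal_sup
    [set ((\int[scalar_variation nu y']_w (vnorm (f w) `^ r)%:E) `^ r^-1)%E
    | y' in @dual_unit_ball Y].

End vector_measures.

(* Main.v *)
(* The variation |y' o nu| of the scalar measure y' o nu is a countably additive
   measure. A strongly measurable function is, off a set null for the
   semivariation (hence for every |y' o nu| with y' in the dual unit ball), a
   pointwise limit of simple functions, so ||f|| and ||g|| become measurable
   once set to 0 on such a set, and this does not affect the integrals.
   Hoelder's inequality for |y' o nu| then gives the bound for each y', and both
   of its factors are at most the corresponding weak norms. *)
Require Import Defs.
From HB Require Import structures.
From mathcomp Require Import all_boot all_order all_algebra.
From mathcomp Require Import complex.
From mathcomp Require Import all_classical all_reals all_analysis.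
From mathcomp Require Import measurable_realfun.

Set Implicit Arguments.
Unset Strict Implicit.
Unset Printing Implicit Defensive.

Import Order.TTheory GRing.Theory Num.Theory.
Import numFieldNormedType.Exports.

Local Open Scope classical_set_scope.
Local Open Scope ring_scope.

(** * Real-valued norms over real or complex scalars *)

Definition of_real (R : realType) (k : scalar_kind) : R -> scalar_field R k :=
  match k with
  | RealScalars => id
  | ComplexScalars => fun r => r%:C%C
  end.

Section scalars.
Context {R : realType} {k : scalar_kind}.
Local Notation K := (scalar_field R k).

Lemma of_real_le (a b : R) : (of_real k a <= of_real k b) = (a <= b).
Proof. by case: k => //=; rewrite lecR. Qed.

Lemma of_real_lt (a b : R) : (of_real k a < of_real k b) = (a < b).
Proof. by case: k => //=; rewrite ltcR. Qed.

Lemma of_realD (a b : R) : of_real k (a + b) = of_real k a + of_real k b.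
Proof. by case: k => //=; rewrite rmorphD. Qed.

Lemma of_real0 : of_real k (0 : R) = 0.
Proof. by case: k. Qed.

Lemma of_real_modulus (z : K) : 0 <= z -> of_real k (modulus z) = z.
Proof.
case: k z => z z0; first exact: (@ger0_norm R).
rewrite /modulus /of_real ger0_norm//.
by case: z z0 => x y; rewrite lecE /= => /andP[/eqP->].
Qed.

Lemma modulus_norm (z : K) : modulus `|z| = modulus z.
Proof.
case: k z => z; first exact: (@normr_id _ R).
by rewrite /modulus normr_id.
Qed.

Context {V : normedModType K}.
Implicit Types v w : V.

(** Since [of_real] is an additive order embedding, this carries the norm inequalities of [V], whose
    values lie in the scalar field, over to the real-valued [vnorm]. *)
Lemma normr_vnorm v : `|v| = of_real k (vnorm v).
Proof. by rewrite of_real_modulus. Qed.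

Lemma vnorm_ge0 v : 0 <= vnorm v.
Proof. by rewrite -of_real_le of_real0 -normr_vnorm. Qed.

Lemma vnorm0 : vnorm (0 : V) = 0.
Proof.
by apply/eqP; rewrite eq_le -!of_real_le -normr_vnorm normr0 of_real0 lexx.
Qed.

Lemma ler_vnormD v w : vnorm (v + w) <= vnorm v + vnorm w.
Proof. by rewrite -of_real_le of_realD -!normr_vnorm ler_normD. Qed.

Lemma ler_vnorm_sum (I : Type) (r : seq I) (F : I -> V) :
  vnorm (\sum_(i <- r) F i) <= \sum_(i <- r) vnorm (F i).
Proof.
elim/big_ind2 : _ => //; first by rewrite vnorm0.
by move=> v a w b va wb; rewrite (le_trans (ler_vnormD _ _)) ?lerD.
Qed.

Lemma vnormN v : vnorm (- v) = vnorm v.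
Proof. by rewrite /vnorm normrN. Qed.

Lemma ler_dist_vnorm v w : `|vnorm v - vnorm w| <= vnorm (v - w).
Proof.
have h (a b : V) : vnorm a - vnorm b <= vnorm (a - b).
  by rewrite lerBlDr -{1}(subrK b a) ler_vnormD.
by rewrite ler_norml h andbT lerNl opprB -(vnormN (v - w)) opprB h.
Qed.

Lemma cvg_vnorm (I : Type) (F : set_system I) (FF : Filter F) (u : I -> V) v :
  u @ F --> v -> (fun i => vnorm (u i)) @ F --> vnorm v.
Proof.
move=> uv; apply/cvgrPdist_lt => e e0.
have e0' : 0 < of_real k e by rewrite -of_real0 of_real_lt.
move/cvgrPdist_lt : uv => /(_ _ e0'); apply: filterS => i.
by rewrite normr_vnorm of_real_lt; apply: le_lt_trans; exact: ler_dist_vnorm.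
Qed.

End scalars.

(** On scalars [vnorm] takes the absolute value twice. The rewriting makes the lemmas on [vnorm]
    available for [modulus]. *)
Lemma vnorm_scalar (R : realType) (k : scalar_kind) (z : (scalar_field R k)^o) :
  vnorm z = modulus z.
Proof. exact: modulus_norm. Qed.

(** * Countable additivity of the variation of a scalar measure *)

Lemma vector_measure0 {d : measure_display} {T : measurableType d}
    (R : realType) (k : scalar_kind) (Y : normedModType (scalar_field R k))
    (nu : set T -> Y) :
  vector_measure nu -> nu set0 = 0.
Proof.
move=> /(_ (fun=> set0) (fun=> measurable0)).
have tr : trivIset setT ((fun=> set0) : (set T)^nat).
  by move=> i j _ _; rewrite setI0 => -[].
move=> /(_ tr); rewrite bigcup0// => h.
(* The partial sums and their shift by one both tend to [nu set0], so their difference, which is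
   constantly [nu set0], tends to 0. *)
have h1 : (fun n => \sum_(0 <= i < n.+1) nu set0) @ \oo --> nu set0.
  by move: h; rewrite -cvg_shiftS.
apply: (@cvg_unique _ (@norm_hausdorff _ Y) (nu set0 @[_ --> \oo])).
  exact: cvg_cst.
have -> : (fun=> nu set0) = (fun n => \sum_(0 <= i < n.+1) nu set0 -
    \sum_(0 <= i < n) nu set0) :> (nat -> Y).
  by apply/funext => n; rewrite big_nat_recr//= addrAC subrr add0r.
by have := cvgB h1 h; rewrite subrr; exact.
Qed.

Section total_variation.
Context {d : measure_display} {T : measurableType d} {R : realType}
        {k : scalar_kind}.
Local Notation K := (scalar_field R k).
Variable mu : set T -> K^o.
Hypothesis mu_sigma : vector_measure mu.

Local Notation tv := (Defs.total_variation (mu : set T -> K)).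

Lemma measure_variation_ge0 E : measurable E -> (0 <= tv E)%E.
Proof.
move=> mE; apply: (@le_trans _ _ (modulus (mu E : K))%:E).
  by rewrite lee_fin -vnorm_scalar vnorm_ge0.
apply: ereal_sup_ubound; exists 1%N, (fun=> E); split => //.
- by move=> i j _ _ _; rewrite (ord1 i) (ord1 j).
- by rewrite bigcup_const//; exists ord0.
- by rewrite big_ord1.
Qed.

Lemma measure_variation0 : tv set0 = 0%E.
Proof.
apply/eqP; rewrite eq_le measure_variation_ge0// andbT.
apply: ge_ereal_sup => _ [n [F [_ _ F0 ->]]].
rewrite big1// => i _; rewrite (_ : F i = set0) ?vector_measure0//.
  by rewrite -vnorm_scalar vnorm0.
by rewrite -subset0 => x Fx; rewrite -F0; exists i.
Qed.

(** A finite partition of [A] followed by one of [B] is a finite partition of the union. The two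
    suprema are then taken one after the other. *)
Lemma measure_variationU A B : measurable A -> measurable B -> A `&` B = set0 ->
  (tv A + tv B <= tv (A `|` B))%E.
Proof.
move=> mA mB AB.
have tvA := measure_variation_ge0 mA; have tvB := measure_variation_ge0 mB.
have key n (F : 'I_n -> set T) m (G : 'I_m -> set T) :
    (forall i, measurable (F i)) -> trivIset setT F -> \bigcup_i F i = A ->
    (forall i, measurable (G i)) -> trivIset setT G -> \bigcup_i G i = B ->
    ((\sum_(i < n) modulus (mu (F i) : K))%:E +
     (\sum_(i < m) modulus (mu (G i) : K))%:E <= tv (A `|` B))%E.
  move=> mF tF FA mG tG GB.
  (* The first [n] indices list the pieces of [F], the last [m] those of [G]. *)
  pose H i := match fintype.split i with inl a => F a | inr b => G b end.
  have Hl i : H (lshift m i) = F i by rewrite /H (unsplitK (inl i)).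
  have Hr i : H (rshift n i) = G i by rewrite /H (unsplitK (inr i)).
  apply: ereal_sup_ubound; exists (n + m)%N, H; split.
  - by move=> i; rewrite /H; case: fintype.split.
  - have FG i j : F i `&` G j = set0.
      rewrite -subset0 => x [Fx Gx]; rewrite -AB -FA -GB.
      by split; [exists i|exists j].
    move=> i j _ _; rewrite -(splitK i) -(splitK j).
    case: (fintype.split i) => a; case: (fintype.split j) => b;
      rewrite /= ?Hl ?Hr.
    + by move=> /tF ->.
    + by rewrite FG => -[].
    + by rewrite setIC FG => -[].
    + by move=> /tG ->.
  - rewrite -FA -GB; apply/seteqP; split => x.
      move=> [i _]; rewrite -(splitK i); case: (fintype.split i) => a;
        rewrite /= ?Hl ?Hr => ?; by [left; exists a|right; exists a].
    move=> [[i _ Fi]|[i _ Gi]].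
    + by exists (lshift m i) => //; rewrite Hl.
    + by exists (rshift n i) => //; rewrite Hr.
  - rewrite big_split_ord/= EFinD; congr (_ + _)%E.
    + by congr EFin; apply: eq_bigr => i _; rewrite Hl.
    + by congr EFin; apply: eq_bigr => i _; rewrite Hr.
(* Once the right-hand side is finite, terms can be subtracted from it, which isolates the quantity
   whose supremum is taken. *)
have [->|tvU] := eqVneq (tv (A `|` B)) +oo%E; first by rewrite leey.
have tvUfin : tv (A `|` B) \is a fin_num.
  rewrite ge0_fin_numE ?ltey// measure_variation_ge0//; exact: measurableU.
have key1 n (F : 'I_n -> set T) :
    (forall i, measurable (F i)) -> trivIset setT F -> \bigcup_i F i = A ->
    ((\sum_(i < n) modulus (mu (F i) : K))%:E + tv B <= tv (A `|` B))%E.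
  move=> mF tF FA; rewrite -leeBrDl//.
  apply: ge_ereal_sup => _ [m [G [mG tG GB ->]]].
  by rewrite leeBrDl// key.
(* Finiteness comes from [key1] applied to the one-piece partition of [A]. *)
have tvBfin : tv B \is a fin_num.
  rewrite ge0_fin_numE//; apply: (@le_lt_trans _ _ (tv (A `|` B))); last first.
    by rewrite ltey.
  have := @key1 1%N (fun=> A) (fun=> mA).
  move/(_ (fun i j _ _ _ => etrans (ord1 i) (esym (ord1 j)))).
  rewrite bigcup_const; last by exists ord0.
  move=> /(_ erefl); apply: le_trans; rewrite leeDr// lee_fin sumr_ge0// => i _.
  by rewrite -vnorm_scalar vnorm_ge0.
rewrite -leeBrDr//; apply: ge_ereal_sup => _ [n [F [mF tF FA ->]]].
by rewrite leeBrDr// key1.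
Qed.

Lemma le_measure_variation A B : measurable A -> measurable B -> A `<=` B ->
  (tv A <= tv B)%E.
Proof.
move=> mA mB AB; rewrite -(setDUK AB).
apply: le_trans (measure_variationU mA (measurableD mB mA) (setDIK _ _)).
by rewrite leeDl// measure_variation_ge0//; exact: measurableD.
Qed.

(** Each piece [F j] of a partition of the union is cut along the [E i]. Countable additivity of
    [mu] and the triangle inequality bound the modulus of [mu (F j)] by the series over its slices.
    After exchanging the sums, the slices inside a fixed [E i] form a partition of [E i]. *)
Lemma measure_variation_sigma_subadditive (E : (set T)^nat) :
  (forall i, measurable (E i)) -> trivIset setT E ->
  (tv (\bigcup_i E i) <= \sum_(0 <= i <oo) tv (E i))%E.
Proof.
move=> mE tE; apply: ge_ereal_sup => _ [n [F [mF tF FE ->]]].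
have modge0 A : 0 <= modulus (mu A : K) by rewrite -vnorm_scalar vnorm_ge0.
have mFE j i : measurable (F j `&` E i) by exact: measurableI.
have muF j : ((modulus (mu (F j) : K))%:E <=
    \sum_(0 <= i <oo) (modulus (mu (F j `&` E i) : K))%:E)%E.
  have := mu_sigma (mFE j) (@trivIset_setIl _ _ _ _ (fun=> F j) tE).
  rewrite -setI_bigcupr -FE setIidl; last by move=> x Fx; exists j.
  move=> /cvg_vnorm cv.
  have : ((vnorm (\sum_(0 <= i < n) mu (F j `&` E i)))%:E @[n --> \oo]
          --> (vnorm (mu (F j)))%:E)%E by exact: cvg_comp cv _.
  rewrite vnorm_scalar => cvE; rewrite -(cvg_lim _ cvE)//.
  apply: lime_le; first by apply/cvg_ex; eexists; exact: cvE.
  apply: nearW => N; apply: le_trans (nneseries_lim_ge N _); last first.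
    by move=> i _ _; rewrite lee_fin.
  rewrite sumEFin lee_fin (le_trans (ler_vnorm_sum _ _))//.
  by under [leRHS]eq_bigr do rewrite -vnorm_scalar.
rewrite -sumEFin; apply: (@le_trans _ _
  (\sum_(j < n) \sum_(0 <= i <oo) (modulus (mu (F j `&` E i) : K))%:E)%E).
  by apply: lee_sum => j _; exact: muF.
rewrite -nneseries_sum; last by move=> j i _; rewrite lee_fin.
apply: lee_nneseries.
  by move=> i _ _; apply: sume_ge0 => j _; rewrite lee_fin.
move=> i _; apply: ereal_sup_ubound; exists n, (fun j => F j `&` E i); split.
- by [].
- exact: trivIset_setIr tF.
- by rewrite -setI_bigcupl FE setIidr//; exact: bigcup_sup.
- by rewrite sumEFin.
Qed.

Lemma measure_variation_sum_le (E : (set T)^nat) n :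
  (forall i, measurable (E i)) -> trivIset setT E ->
  (\sum_(0 <= i < n) tv (E i) <= tv (\big[setU/set0]_(0 <= i < n) E i))%E.
Proof.
move=> mE tE; elim: n => [|n ih]; first by rewrite !big_nil measure_variation0.
rewrite !big_nat_recr//=; apply: le_trans (measure_variationU _ _ _) => //.
- by rewrite leeD2r.
- exact: bigsetU_measurable.
- rewrite big_mkord; rewrite -subset0 => x [+ Ex].
  rewrite -bigcup_mkord => -[i /= ni Eix].
  have /(_ i n I I) := tE => /(_ (ex_intro _ x (conj Eix Ex))) ein.
  by rewrite ein ltnn in ni.
Qed.

(* [Defs.total_variation] is -oo on a non-measurable set (the supremum of the
   empty set), whereas a measure must be nonnegative on every set. *)
Definition variation_measure of vector_measure mu :=
  fun E : set T => maxe 0%E (tv E) : \bar R.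

Lemma variation_measureE E :
  measurable E -> variation_measure mu_sigma E = tv E.
Proof. by move=> mE; apply/max_idPr; exact: measure_variation_ge0. Qed.

Let variation_measure0 : variation_measure mu_sigma set0 = 0%E.
Proof. by rewrite variation_measureE// measure_variation0. Qed.

Let variation_measure_ge0 E : (0 <= variation_measure mu_sigma E)%E.
Proof. by rewrite le_max lexx. Qed.

Let variation_measure_sigma_additive :
  semi_sigma_additive (variation_measure mu_sigma).
Proof.
move=> E mE tE mUE; rewrite variation_measureE//.
under eq_fun do under eq_bigr do rewrite variation_measureE//.
have tv0 i : (0 <= tv (E i))%E by exact: measure_variation_ge0.
have -> : tv (\bigcup_n E n) = (\sum_(0 <= i <oo) tv (E i))%E.
  apply/eqP; rewrite eq_le measure_variation_sigma_subadditive//=.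
  (* The converse inequality holds for every partial sum, by finite superadditivity and
     monotonicity, and passes to the limit. *)
  apply: lime_le; first exact: is_cvg_nneseries.
  apply: nearW => n; apply: le_trans (measure_variation_sum_le _ _ _) _ => //.
  apply: le_measure_variation => //; first exact: bigsetU_measurable.
  by rewrite big_mkord; exact: bigsetU_bigcup.
exact: is_cvg_nneseries.
Qed.

HB.instance Definition _ := isMeasure.Build d T R (variation_measure mu_sigma)
  variation_measure0 variation_measure_ge0 variation_measure_sigma_additive.

End total_variation.

(** * Integrals of possibly nonmeasurable functions *)

Section integral.
Context {d : measure_display} {T : measurableType d} {R : realType}.
Local Open Scope ereal_scope.

Import HBNNSimple.

(** The integral evaluates the set function only on level sets of simple functions, which are
    measurable. Hence [scalar_variation] can be exchanged for the genuine measure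
    [variation_measure]. *)
Lemma eq_integral_measurable (m1 m2 : set T -> \bar R) (f : T -> \bar R) :
  (forall A, measurable A -> m1 A = m2 A) ->
  \int[m1]_w f w = \int[m2]_w f w.
Proof.
move=> m12.
have s12 (h : {nnsfun T >-> R}) : sintegral m1 h = sintegral m2 h.
  by apply: eq_fsbigr => r _; rewrite m12.
rewrite /integral; congr (ereal_sup _ - ereal_sup _);
  by apply: eq_imagel => h _; exact: s12.
Qed.

(* The integrals are suprema over measurable simple minorants, and a minorant of
   [f] set to 0 on [N] minorizes [g]. *)
Lemma ge0_le_integral_off_null (m : {measure set T -> \bar R}) (N : set T)
    (f g : T -> \bar R) : measurable N -> m N = 0 ->
  (forall w, 0 <= f w) -> (forall w, 0 <= g w) ->
  (forall w, ~ N w -> f w <= g w) ->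
  \int[m]_w f w <= \int[m]_w g w.
Proof.
move=> mN N0 f0 g0 fg; rewrite !ge0_integralTE//.
apply: ge_ereal_sup => _ [h hf <-].
pose h' := mul_nnsfun h (indic_nnsfun R (measurableC mN)).
have h'E w : h' w = (h w * \1_(~` N) w)%R by [].
have -> : sintegral m h = sintegral m h'.
  rewrite -!integralT_nnsfun; apply: ae_eq_integral => //.
  - exact/measurable_EFinP.
  - exact/measurable_EFinP.
  - exists N; split => // w; apply: contraPP => Nw; apply => _.
    by rewrite h'E indicE mem_set// mulr1.
apply: ereal_sup_ubound; exists h' => // w; rewrite h'E indicE.
have [/set_mem Nw|_] := boolP (w \in ~` N); rewrite ?mulr1 ?mulr0//.
by rewrite (le_trans (hf w))// fg.
Qed.

End integral.

(** * Measurability of the norm of a strongly measurable function *)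

Section simple.
Context {d : measure_display} {T : measurableType d} {R : realType}
        {k : scalar_kind} {X Y : normedModType (scalar_field R k)}.

(** The sets [A i] may overlap, so the value at a point is determined by the Boolean vector [b] of
    its memberships. The preimage of [B] is the finite union of the atoms, indexed by [b], on which
    the norm [c b] lies in [B]. *)
Lemma measurable_vnorm_simple (s : T -> X) : simple_function s ->
  measurable_fun setT (fun w => vnorm (s w)).
Proof.
move=> [n [x [A [mA ->]]]] _ B mB; rewrite setTI.
pose c (b : {ffun 'I_n -> bool}) :=
  vnorm (\sum_(i < n) ((b i)%:R : scalar_field R k) *: x i).
rewrite [X in measurable X](_ : _ = \bigcup_(b in [set b | B (c b)])
    \bigcap_(i in [set: 'I_n]) (if b i then A i else ~` A i)).
  apply: fin_bigcup_measurable => // b _.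
  apply: fin_bigcap_measurable => // i _.
  by case: ifP => // _; exact: measurableC.
apply/seteqP; split => w /=.
  move=> Bw; exists [ffun i => w \in A i].
    rewrite /= /c; move: Bw.
    under eq_bigr do rewrite indicE.
    by under [in X in _ -> X]eq_bigr do rewrite ffunE.
  by move=> i _; rewrite ffunE; case: ifPn => [/set_mem|/negP wA /mem_set].
move=> [b /= Bb bw].
suff -> : \sum_(i < n) (\1_(A i) w : scalar_field R k) *: x i =
  \sum_(i < n) ((b i)%:R : scalar_field R k) *: x i by [].
apply: eq_bigr => i _; rewrite indicE; congr (_%:R *: _).
by have := bw i I; case: (b i) => wA; [rewrite mem_set|rewrite memNset].
Qed.

(** [N] is a measurable null set containing all points of nonconvergence. Multiplying by the
    indicator of its complement turns convergence almost everywhere into convergence everywhere. *)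
Lemma nu_measurable_vnorm (nu : set T -> Y) (f : T -> X) :
  nu_measurable nu f -> exists N, [/\ measurable N, semivariation nu N = 0%E &
    measurable_fun setT (fun w => vnorm (f w) * \1_(~` N) w)].
Proof.
move=> [s [ss [N [mN N0 sN]]]]; exists N; split => //.
apply: (@measurable_fun_cvg _ _ _ _
  (fun n w => vnorm (s n w) * \1_(~` N) w)) => //.
  move=> n; apply: measurable_funM; first exact: measurable_vnorm_simple.
  by apply: measurable_indic; exact: measurableC.
move=> w _; have [wN|wN] := pselect (N w).
  rewrite indicE memNset; last by move=> /(_ wN).
  by rewrite mulr0; under eq_fun do rewrite mulr0; exact: cvg_cst.
rewrite indicE mem_set// mulr1; under eq_fun do rewrite mulr1.
by apply: cvg_vnorm; apply: contrapT => ncvg; exact/wN/sN.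
Qed.

End simple.

(** * Functionals in the dual unit ball and the weak norm *)

Section scalar_variation.
Context {d : measure_display} {T : measurableType d} {R : realType}
        {k : scalar_kind} {X Y : normedModType (scalar_field R k)}.
Variable nu : set T -> Y.

Lemma vector_measure_comp (y' : {linear Y -> (scalar_field R k)^o}) :
  vector_measure nu -> continuous (y' : Y -> (scalar_field R k)^o) ->
  vector_measure (y' \o nu).
Proof.
move=> nu_measure cy' A mA tA; rewrite [X in X @ _ --> _](_ : _ =
    y' \o (fun n => \sum_(0 <= i < n) nu (A i))).
  by apply: continuous_cvg; [exact: cy'|exact: nu_measure].
by apply/funext => n /=; rewrite linear_sum.
Qed.

Lemma scalar_variation_null (y' : {linear Y -> (scalar_field R k)^o}) N :
  measurable N -> dual_unit_ball y' -> semivariation nu N = 0%E ->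
  scalar_variation nu y' N = 0%E.
Proof.
move=> mN y'1 N0; apply/eqP; rewrite eq_le; apply/andP; split.
  by rewrite -N0; apply: ereal_sup_ubound; exists y'.
exact: (measure_variation_ge0 (y' \o nu) mN).
Qed.

(** Cutting [f] off on [N] only decreases the integrand, and the integral of the uncut function is
    one of those in the supremum defining [Lw_norm]. *)
Lemma Lnorm_le_Lw_norm (y' : {linear Y -> (scalar_field R k)^o})
    (m : {measure set T -> \bar R}) (r : R) (N : set T) (f : T -> X) :
  dual_unit_ball y' ->
  (forall A, measurable A -> m A = scalar_variation nu y' A) -> 0 < r ->
  (Lnorm m r%:E (fun w => (vnorm (f w) * \1_(~` N) w)%:E) <= Lw_norm nu r f)%E.
Proof.
move=> y'1 mE r0; apply: (@le_trans _ _
    ((\int[scalar_variation nu y']_w (vnorm (f w) `^ r)%:E) `^ r^-1)%E);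
  last first.
  by apply: ereal_sup_ubound; exists y'.
rewrite unlock -(eq_integral_measurable _ mE); apply: gt0_ler_poweR.
- by rewrite invr_ge0 ltW.
- by rewrite in_itv/= leey andbT integral_ge0// => w _; exact: poweR_ge0.
- rewrite in_itv/= leey andbT integral_ge0// => w _.
  by rewrite lee_fin powR_ge0.
(* With the empty set as null set, this is monotonicity of the integral for integrands that may fail
   to be measurable. *)
apply: (ge0_le_integral_off_null (@measurable0 _ T)) => //.
- by move=> w; exact: poweR_ge0.
- by move=> w; rewrite lee_fin powR_ge0.
move=> w _; rewrite abse_EFin poweR_EFin lee_fin.
rewrite ge0_ler_powR ?nnegrE ?normr_ge0 ?vnorm_ge0 ?(ltW r0)//.
rewrite normrM ger0_norm ?vnorm_ge0// indicE.
by case: (_ \in _); rewrite ?normr1 ?normr0 ?mulr1 ?mulr0 ?vnorm_ge0.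
Qed.

End scalar_variation.

(** * Hölder's inequality for the weak norms *)

Theorem proposition3p6 (R : realType) (k : scalar_kind) (p q : R)
    (p1 : 1 < p) (pq : p^-1 + q^-1 = 1)
    (d : measure_display) (T : measurableType d)
    (X Y : completeNormedModType (scalar_field R k))
    (nu : set T -> Y) (nu_measure : vector_measure nu)
    (f g : T -> X) (fLp : in_Lw nu p f) (gLq : in_Lw nu q g) :
  (ereal_sup [set \int[scalar_variation nu y']_w
                    (vnorm (f w) * vnorm (g w))%:E
             | y' in @dual_unit_ball R k Y]
   <= Lw_norm nu p f * Lw_norm nu q g)%E.
Proof.
have p0 : 0 < p := lt_trans ltr01 p1.
have q0 : 0 < q.
  (* The inverse of [q] is 1 minus the inverse of [p], which is positive because [p] exceeds 1. *)
  by rewrite -invr_gt0 -(ltrDl p^-1) pq invf_lt1.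
have [Nf [mNf Nf0 mf]] := nu_measurable_vnorm fLp.1.
have [Ng [mNg Ng0 mg]] := nu_measurable_vnorm gLq.1.
apply: ge_ereal_sup => _ [y' y'1 <-].
have vm := vector_measure_comp nu_measure y'1.1.
pose m : {measure set T -> \bar R} := variation_measure vm.
have mE A : measurable A -> m A = scalar_variation nu y' A.
  exact: variation_measureE.
have m0 N : measurable N -> semivariation nu N = 0%E -> m N = 0%E.
  by move=> mN N0; rewrite mE// (scalar_variation_null mN y'1).
have mNN : m (Nf `|` Ng) = 0%E.
  by apply: null_set_setU => //; exact: m0.
rewrite -(eq_integral_measurable _ mE).
(* The intermediate term uses the cut-off norms, which are measurable as [hoelder] requires. Off the
   null set [Nf] union [Ng] their product is the original integrand. *)
apply: (@le_trans _ _ (Lnorm m 1%:E (EFin \o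
    ((fun w => vnorm (f w) * \1_(~` Nf) w) \*
     (fun w => vnorm (g w) * \1_(~` Ng) w))))).
  rewrite Lnorm1.
  apply: (ge0_le_integral_off_null (measurableU _ _ mNf mNg)) => //.
  - by move=> w; rewrite lee_fin mulr_ge0 ?vnorm_ge0.
  - move=> w /not_orP[Nfw Ngw]; rewrite /= !indicE !mem_set// !mulr1 lee_fin.
    exact: ler_norm.
apply: le_trans (hoelder m mf mg p0 q0 pq) _.
by apply: lee_pmul; rewrite ?Lnorm_ge0// (Lnorm_le_Lw_norm _ _ y'1).
Qed.
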